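(* Let $\beta$ be an extended real number satisfying $2^+\leq \beta\leq 8/3$. Then there are arbitrarily long extremal $\beta$-free words over $\Sigma_2=\{\mathtt{0},\mathtt{1}\}$.
   Context: For a word $w=w_1\cdots w_n$, $p\ge1$ is a period if $w_{i+p}=w_i$ for all $1\le i\le n-p$; the exponent of $w$ is $|w|$ divided by its minimal period. The extended reals consist of all real numbers $x$ together with symbols $x^+$, where $x^+$ covers $x$ and for reals $y$, ''$y\le x$'' and ''$y<x^+$'' are equivalent (so ''exponent $\ge x^+$'' means ''exponent $> x$''). For an extended real $\beta$, a word is $\beta$-free if none of its factors has exponent $\geq\beta$. An extension of a word $w$ over alphabet $\Sigma$ is a word $w'aw''$ with $a\in\Sigma$ and $w'w''=w$. A word $w$ is extremal $\beta$-free if $w$ is $\beta$-free and every extension of $w$ contains a factor of exponent $\ge\beta$. *)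

(* Defs.v *)
From mathcomp Require Import all_boot all_order all_algebra.
From mathcomp Require Import reals.

Set Implicit Arguments.
Unset Strict Implicit.
Unset Printing Implicit Defensive.

Import Order.TTheory GRing.Theory Num.Theory.
Local Open Scope ring_scope.

(* (x, false) is the real number x and (x, true) is x^+; the order is the
   lexicographic one, with false < true, so that x^+ covers x. *)
Definition extended (R : realType) := (R *l bool)%type.

Definition xreal (R : realType) (x : R) : extended R := (x, false).
Definition xplus (R : realType) (x : R) : extended R := (x, true).

Lemma xreal_le_real (R : realType) (x y : R) :
  (xreal x <= xreal y)%O = (x <= y).
Proof. by rewrite lexi_pair /= implybT andbT. Qed.

Lemma xplus_le_plus (R : realType) (x y : R) :
  (xplus x <= xplus y)%O = (x <= y).
Proof. by rewrite lexi_pair /= implybT andbT. Qed.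

Lemma xreal_le_plus (R : realType) (x y : R) :
  (xreal x <= xplus y)%O = (x <= y).
Proof. by rewrite lexi_pair /= implybT andbT. Qed.

Lemma xplus_le_real (R : realType) (x y : R) :
  (xplus x <= xreal y)%O = (x < y).
Proof. by rewrite lexi_pair /= implybF -ltNge lt_neqAle; case: ltgtP. Qed.

Lemma xreal_lt_plus (R : realType) (x y : R) :
  (xreal y < xplus x)%O = (xreal y <= xreal x)%O.
Proof. by rewrite xreal_le_real ltxi_pair /= implybT andbT. Qed.

Lemma xplus_covers (R : realType) (x : R) (z : extended R) :
  (xreal x < xplus x)%O /\ ~~ ((xreal x < z)%O && (z < xplus x)%O).
Proof.
split; first by rewrite xreal_lt_plus.
by case: z => z []; rewrite !ltxi_pair /=; case: (ltgtP x z) => //= ->.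
Qed.

Section Words.
Variable T : eqType.
Implicit Types (u v w : seq T) (p : nat).

Definition is_period w p : bool :=
  (1 <= p)%N && [forall i : 'I_(size w - p), onth w (i + p) == onth w i].

Lemma ex_period w : exists p, is_period w p.
Proof.
exists (size w).+1; apply/andP; split=> //.
by apply/forallP=> -[i hi]; exfalso; move: hi; rewrite subnS subnn.
Qed.

Definition min_period w : nat := ex_minn (ex_period w).

Definition exponent (R : realType) w : R := (size w)%:R / (min_period w)%:R.

Definition has_large_factor (R : realType) (beta : extended R) w : Prop :=
  exists2 u, infix u w & (beta <= xreal (exponent R u))%O.

Definition beta_free (R : realType) (beta : extended R) w : Prop :=
  ~ has_large_factor beta w.

Definition extension w v : Prop :=
  exists w' a w'', v = w' ++ a :: w'' /\ w' ++ w'' = w.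

Definition extremal_free (R : realType) (beta : extended R) w : Prop :=
  beta_free beta w /\ forall v, extension w v -> has_large_factor beta v.

End Words.

(* Main.v *)
(* The range of exponents is cut at 2 < 7/3 < 12/5 < 5/2 < 13/5 < 8/3: if all
   factors of w have exponent at most A and every extension of w has a factor of
   exponent at least B, then w is extremal beta-free for all A+ <= beta <= B.  For
   each of the five pairs (A, B), w is a long factor of the image x of the
   Thue-Morse word by a uniform morphism, surrounded by two fixed short words
   chosen so that neither end can be extended.

   The effect of an insertion is local, hence seen on finitely many windows, and so
   are the powers of short period.  A power of long period and exponent > 2 cannot
   touch the ends, each of which carries a factor occurring nowhere else in w; so
   it lies in x.  Since windows of x determine their position modulo the length of
   the morphism, its period is a multiple of that length, and since the images of
   the two letters differ in their first and last letters, it projects onto an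
   overlap of the Thue-Morse word, which is impossible. *)

From Stdlib Require Import Strings.String.
Require Import Defs.
From mathcomp Require Import all_boot all_order all_algebra.
From mathcomp Require Import reals.
From mathcomp Require Import zify.

Set Implicit Arguments.
Unset Strict Implicit.
Unset Printing Implicit Defensive.

(** * The Thue-Morse word *)

(** With enough fuel [k], this is the parity of the number of ones in binary [n]. *)
Fixpoint tm_rec k n := if k is k'.+1 then odd n (+) tm_rec k' n./2 else false.

Definition tm n := tm_rec n n.

Lemma tm_rec0 k : tm_rec k 0 = false.
Proof. by elim: k => //= k ->. Qed.

Lemma tm_recE k l n : n <= k -> n <= l -> tm_rec k n = tm_rec l n.
Proof.
elim: k l n => [|k IHk] [|l] n //.
- by rewrite leqn0 => /eqP-> _; rewrite !tm_rec0.
- by rewrite leqn0 => _ /eqP->; rewrite !tm_rec0.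
by move=> hk hl /=; rewrite (IHk l) //; lia.
Qed.

Lemma tm_half n : tm n = odd n (+) tm n./2.
Proof.
case: n => // n; rewrite /tm [LHS]/=; congr (_ (+) _).
by apply: tm_recE; lia.
Qed.

Lemma tm_double n : tm n.*2 = tm n.
Proof. by rewrite tm_half odd_double doubleK. Qed.

Lemma tm_doubleS n : tm n.*2.+1 = ~~ tm n.
Proof. by rewrite tm_half /= odd_double uphalf_double. Qed.

(** The factor 3 puts two more ones in front of the binary digits of [i], which keeps their
    parity. *)
Lemma tm_shift j i : i < 2 ^ j -> tm (3 * 2 ^ j + i) = tm i.
Proof.
elim: j i => [|j IHj] i; first by case: i.
rewrite expnS => hi; have hi2 : i./2 < 2 ^ j by move: (2 ^ j) hi => P; lia.
rewrite tm_half [RHS]tm_half -(IHj _ hi2).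
by congr (_ (+) tm _); move: (2 ^ j) => P; lia.
Qed.

Lemma tm_aligned n : ~~ odd n -> tm n.+1 = ~~ tm n.
Proof. by move=> /even_halfK <-; rewrite tm_doubleS tm_double. Qed.

(** One of the two adjacent pairs starts at an even position, where the letters differ. *)
Lemma tm_cube_free n : ~ (tm n.+1 = tm n /\ tm n.+2 = tm n.+1).
Proof.
case: (boolP (odd n)) => hn [e1 e2].
  by have := @tm_aligned n.+1; rewrite /= hn e2 => /(_ isT); case: tm.
by have := tm_aligned hn; rewrite e1; case: tm.
Qed.

Lemma tm_not_alternating n : ~ (forall s, s < 6 -> tm (n + s).+1 = ~~ tm (n + s)).
Proof.
move=> alt.
(* Positions 2d+1 and 2d+2 carry [~~ tm d] and [tm d.+1], so alternation there equates [tm d] and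
   [tm d.+1]; two consecutive such [d] give a cube of a letter. *)
have odd_pair d : n <= d.*2.+1 < n + 6 -> tm d.+1 = tm d.
  move=> hd; have := alt (d.*2.+1 - n) ltac:(lia).
  rewrite subnKC; last lia.
  by rewrite -doubleS tm_double tm_doubleS negbK.
by apply: (@tm_cube_free (uphalf n)); split; apply: odd_pair; lia.
Qed.

(* For an odd period, one of an adjacent pair and its translate is an aligned
   pair [2m, 2m+1], so the run would alternate; a run of even period halves. *)
Lemma tm_overlap_free i p :
  0 < p -> ~ (forall s, s <= p -> tm (i + s + p) = tm (i + s)).
Proof.
elim/ltn_ind: p i => p IHp i p0 run.
case: (boolP (odd p)) => hp; last first.
  apply: (IHp p./2 _ i./2); [lia|lia|] => s hs.
  have := run s.*2 ltac:(lia).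
  case: (boolP (odd i)) => hi.
    have -> : i + s.*2 + p = (i./2 + s + p./2).*2.+1 by lia.
    have -> : i + s.*2 = (i./2 + s).*2.+1 by lia.
    by rewrite !tm_doubleS => /negb_inj.
  have -> : i + s.*2 + p = (i./2 + s + p./2).*2 by lia.
  have -> : i + s.*2 = (i./2 + s).*2 by lia.
  by rewrite !tm_double.
have alt s : s < p.*2 -> tm (i + s).+1 = ~~ tm (i + s).
  move=> hs; case: (boolP (odd (i + s))) => [his|]; last exact: tm_aligned.
  case: (ltnP s p) => hsp.
    have e1 := run s ltac:(lia); have e2 := run s.+1 ltac:(lia).
    rewrite -e1 -[(i + s).+1]addnS -e2 addnS.
    by apply: tm_aligned; rewrite oddD his hp.
  have [r er] : exists r, s = r + p by exists (s - p); lia.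
  rewrite er addnA in his *.
  have e1 := run r ltac:(lia); have e2 := run r.+1 ltac:(lia).
  rewrite -addSn -addnS e2 e1 addnS; apply: tm_aligned.
  by move: his; rewrite oddD hp addbT.
(* For odd [p] above 2 there are 2p, hence at least six, alternating steps; [p = 1] leaves a cube of
   a letter. *)
case: (ltnP 2 p) => hp2.
  by apply: (@tm_not_alternating i) => s hs; apply: alt; lia.
have ep : p = 1 by lia.
have := run 0 isT; have := run 1; rewrite ep !addn0 !addn1 => /(_ isT) e2 e1.
exact: (@tm_cube_free i).
Qed.

(** * Uniform morphic images of the Thue-Morse word *)

Definition sub i m (w : seq bool) := take m (drop i w).

Definition periodic p (w : seq bool) := drop p w == take (size w - p) w.

Lemma size_sub i m w : i + m <= size w -> size (sub i m w) = m.
Proof. by move=> h; rewrite size_take size_drop; case: ltngtP; lia. Qed.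

Lemma nth_sub i m w s : s < m -> nth false (sub i m w) s = nth false w (i + s).
Proof. by move=> h; rewrite nth_take // nth_drop. Qed.

Lemma eq_sub (w w' : seq bool) i i' m :
  i + m <= size w -> i' + m <= size w' ->
  (forall s, s < m -> nth false w (i + s) = nth false w' (i' + s)) ->
  sub i m w = sub i' m w'.
Proof.
move=> hw hw' e; apply: (@eq_from_nth _ false); rewrite !size_sub // => s hs.
by rewrite !nth_sub // e.
Qed.

Lemma periodicP p w :
  reflect (forall s, s + p < size w -> nth false w (s + p) = nth false w s)
          (periodic p w).
Proof.
apply: (iffP eqP) => [e s hs|h].
  have hs' : s < size w - p by lia.
  by have := congr1 (nth false ^~ s) e; rewrite nth_drop (nth_take _ hs') addnC.
apply: (@eq_from_nth _ false); first by rewrite size_drop size_takel; lia.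
move=> s; rewrite size_drop => hs.
by rewrite nth_drop nth_take // addnC; apply: h; lia.
Qed.

Lemma is_period_periodic p w : is_period w p = (0 < p) && periodic p w.
Proof.
congr (_ && _); apply/forallP/periodicP => [h s hs|h [s hs] /=].
  have hs' : s < size w - p by rewrite ltn_subRL addnC.
  have hs0 : s < size w by apply: leq_ltn_trans hs; exact: leq_addr.
  by rewrite -!odflt_onth (eqP (h (Ordinal hs'))).
have hs1 : s + p < size w by rewrite addnC -ltn_subRL.
have hs0 : s < size w by apply: leq_ltn_trans hs1; exact: leq_addr.
by rewrite !onthE !(nth_map false) ?h.
Qed.

Section Coding.
Variable h : bool -> seq bool.

Definition width := size (h false).

Definition coded n := nth false (h (tm (n %/ width))) (n %% width).

Definition coded_sub i m := mkseq (fun s => coded (i + s)) m.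

Lemma size_coded_sub i m : size (coded_sub i m) = m.
Proof. exact: size_mkseq. Qed.

Lemma coded_sub_cat i m1 m2 :
  coded_sub i (m1 + m2) = coded_sub i m1 ++ coded_sub (i + m1) m2.
Proof.
rewrite /coded_sub /mkseq iotaD map_cat; congr (_ ++ _).
rewrite add0n -[X in iota X](addn0 m1) iotaDl -map_comp.
by apply: eq_map => s /=; rewrite addnA.
Qed.

(** The image under [h] of the [k]-th iterate of the Thue-Morse morphism 0 -> 01, 1 -> 10 on [b]. *)
Fixpoint block k b := if k is k'.+1 then block k' b ++ block k' (~~ b) else h b.

Definition coded_wins k m : seq (nat * seq bool) :=
  [seq (r, sub r m (block k ab.1 ++ block k ab.2))
     | ab <- [:: (false, false); (false, true); (true, false); (true, true)],
       r <- iota 0 (width * 2 ^ k)].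

Hypothesis width_gt0 : 0 < width.

Lemma coded_shift j i : i < width * 2 ^ j -> coded (3 * (width * 2 ^ j) + i) = coded i.
Proof.
move=> hi; rewrite /coded.
have -> : 3 * (width * 2 ^ j) + i = 3 * 2 ^ j * width + i by lia.
by rewrite modnMDl divnMDl // tm_shift // ltn_divLR // mulnC.
Qed.

Lemma coded_inj r a b :
  nth false (h false) r != nth false (h true) r ->
  nth false (h a) r = nth false (h b) r -> a = b.
Proof. by case: a; case: b => // /eqP hr e; case: hr. Qed.

(* A run of length 2p + 1 meets p / width + 1 blocks in its first half, each in
   its first or its last letter, hence projects onto an overlap of tm. *)
Lemma coded_overlap_free i p :
  nth false (h false) 0 != nth false (h true) 0 ->
  nth false (h false) width.-1 != nth false (h true) width.-1 ->
  0 < p -> width %| p -> ~ (forall s, s <= p -> coded (i + s + p) = coded (i + s)).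
Proof.
move=> head_neq last_neq p0 /dvdnP[p' ep] run; have p'0 : 0 < p' by case: p' ep p0 => // ->.
apply: (@tm_overlap_free (i %/ width) p') => // s hs.
have pos r : r < width -> i <= (i %/ width + s) * width + r <= i + p ->
    nth false (h false) r != nth false (h true) r ->
    tm (i %/ width + s + p') = tm (i %/ width + s).
  move=> hr hi neq; apply: (coded_inj neq).
  have := run ((i %/ width + s) * width + r - i) ltac:(lia).
  rewrite subnKC; last lia.
  have -> : (i %/ width + s) * width + r + p = (i %/ width + s + p') * width + r by lia.
  rewrite /coded !divnMDl // !modnMDl.
  by rewrite (divn_small hr) (modn_small hr) !addn0.
have := divn_eq i width; have := ltn_pmod i width_gt0.
have hsw : s * width <= p by rewrite ep leq_mul2r hs orbT.
case: s hs hsw pos => [|s] hs hsw pos hmod hdiv.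
  by apply: (pos width.-1); rewrite ?ltn_predL //; nia.
by apply: (pos 0) => //; nia.
Qed.

Hypothesis size_h1 : size (h true) = width.

Lemma size_block k b : size (block k b) = width * 2 ^ k.
Proof.
elim: k b => [|k IHk] b /=; first by rewrite muln1; case: b.
by rewrite size_cat !IHk expnS; lia.
Qed.

(** Going up one level, the parity of the block index selects the half of the larger block, by
    [tm_half]. *)
Lemma coded_block k n :
  coded n = nth false (block k (tm (n %/ (width * 2 ^ k)))) (n %% (width * 2 ^ k)).
Proof.
elim: k => [|k ->]; first by rewrite muln1.
have Q0 : 0 < width * 2 ^ k by rewrite muln_gt0 width_gt0 expn_gt0.
rewrite expnS mulnCA [_ * (_ * _)]mulnC /= nth_cat size_block.
set Q := width * 2 ^ k in Q0 *; set J := n %/ Q; set r := n %% Q.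
have hr : r < Q by rewrite ltn_mod.
have -> : n %% (Q * 2) = odd J * Q + r.
  rewrite [n in LHS](divn_eq n Q) -/J -/r -{1}(odd_double_half J).
  have -> : (odd J + J./2.*2) * Q + r = J./2 * (Q * 2) + (odd J * Q + r) by nia.
  by rewrite modnMDl modn_small //; case: (odd J); lia.
have -> : n %/ (Q * 2) = J./2 by rewrite divnMA divn2.
rewrite [in LHS]tm_half; case: (odd J) => /=; last by rewrite mul0n add0n hr.
by rewrite mul1n ltnNge leq_addr addKn.
Qed.

Lemma coded_sub_win k i m :
  m <= width * 2 ^ k -> (i %% (width * 2 ^ k), coded_sub i m) \in coded_wins k m.
Proof.
have Q0 : 0 < width * 2 ^ k by rewrite muln_gt0 width_gt0 expn_gt0.
move=> hm; set Q := width * 2 ^ k in Q0 hm *; set J := i %/ Q; set r := i %% Q.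
have hr : r < Q by rewrite ltn_mod.
have -> : coded_sub i m = sub r m (block k (tm J) ++ block k (tm J.+1)).
  apply: (@eq_from_nth _ false) => [|s]; rewrite size_mkseq.
    by rewrite size_sub // size_cat !size_block -/Q; lia.
  move=> hs; rewrite nth_sub // nth_mkseq // (coded_block k) nth_cat size_block -/Q.
  rewrite [i in LHS](divn_eq i Q) -/J -/r -addnA divnMDl // modnMDl.
  case: ltnP => hrs; first by rewrite divn_small ?modn_small ?addn0.
  have [s' es] : exists s', r + s = 1 * Q + s' by exists (r + s - Q); lia.
  have hs' : s' < Q by lia.
  by rewrite es divnMDl // modnMDl mul1n addKn divn_small // modn_small // addn0 addn1.
apply/allpairsP; exists ((tm J, tm J.+1), r); split=> //=.
  by case: (tm J); case: (tm J.+1); rewrite !inE.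
by rewrite mem_iota.
Qed.

End Coding.

(** * A family of words with finitely checkable properties *)

Definition ins i b (w : seq bool) := take i w ++ b :: drop i w.

Lemma infix_sub i m w : infix (sub i m w) w.
Proof. by apply/infixP; exists (take i w), (drop m (drop i w)); rewrite !cat_take_drop. Qed.

Lemma infixE (u w : seq bool) :
  infix u w -> exists i, u = sub i (size u) w /\ i + size u <= size w.
Proof.
case/infixP=> s1 [s2 ->]; exists (size s1).
by rewrite /sub drop_size_cat // take_size_cat // !size_cat addnA leq_addr.
Qed.

Lemma infix_ins_sub i lo m b w :
  lo <= i <= lo + m -> lo + m <= size w ->
  infix (ins (i - lo) b (sub lo m w)) (ins i b w).
Proof.
move=> /andP[lo_i i_hi] hi_w; apply/infixP; exists (take lo w), (drop (lo + m) w).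
rewrite /ins /sub take_takel; last lia.
have {1}-> : i = (i - lo) + lo by lia.
have {2}-> : i = (i - lo) + lo by lia.
rewrite -drop_drop.
have -> : take (i - lo + lo) w = take lo w ++ take (i - lo) (drop lo w).
  by rewrite -{1}[w](cat_take_drop lo) take_cat size_takel ?ltnNge ?leq_addl //=;
    [rewrite addnK|lia].
rewrite -!catA /=; congr (_ ++ (_ ++ _ :: _)).
set v := drop lo w; have -> : drop (lo + m) w = drop m v by rewrite drop_drop addnC.
have hv : m <= size v by rewrite size_drop; lia.
rewrite -{1}[v](cat_take_drop m) drop_cat size_takel //.
case: ltnP => // hm; have -> : i - lo = m by lia.
by rewrite subnn drop0 [drop m (take m v)]drop_oversize ?size_takel.
Qed.

(* The pair e stands for the exponent e.1 / e.2; L is the least length that makes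
   the exponent of a word of period p at least this bound. *)
Definition has_power (e : nat * nat) w :=
  has (fun p => let L := (e.1 * p + e.2.-1) %/ e.2 in
         has (fun i => periodic p (sub i L w)) (iota 0 ((size w).+1 - L)))
      (iota 1 (size w)).

Lemma has_powerP e w :
  0 < e.2 -> has_power e w ->
  exists u p, [/\ infix u w, is_period u p & e.1 * p <= size u * e.2].
Proof.
move=> e0 /hasP[p]; rewrite mem_iota => hp; set L := _ %/ _.
case/hasP=> i; rewrite mem_iota => hi per.
exists (sub i L w), p; split; first exact: infix_sub.
  by rewrite is_period_periodic per andbT; case/andP: hp.
rewrite size_sub; last lia.
have := divn_eq (e.1 * p + e.2.-1) e.2; have := ltn_pmod (e.1 * p + e.2.-1) e0.
by rewrite -/L; lia.
Qed.

Definition ins_power e i w := has_power e (ins i false w) && has_power e (ins i true w).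

(* The words of a family are [lft ++ x_start ... x_(stop' - 1) ++ rgt], where [x]
   is the image of the Thue-Morse word by [img] and [stop' = stop + 3 Q] with [Q]
   a large multiple of the block length, so that they all end with the [margin]
   letters of [x] before [stop], followed by [rgt].  Their exponents are at most
   [low], and every extension has a factor of exponent at least [high].  Every
   window of [margin] letters of [x] lies in two consecutive [level]-blocks.
   The factor of length [marker] starting at the last letter of [lft], or ending at
   the first letter of [rgt], occurs only once.  Periods below [pmin] are excluded
   by inspection of windows.  An inserted letter creates a large power within
   [reach] letters, except near the ends, where [margin] letters are used. *)
Record spec := Spec {
  img : bool -> seq bool;
  lft : seq bool;
  rgt : seq bool;
  start : nat;
  stop : nat;
  low : nat * nat;
  high : nat * nat;
  margin : nat;
  level : nat;
  marker : nat;
  pmin : nat;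
  reach : nat
}.

Section Family.
Variable S : spec.
Let q := width (img S).
Let K := margin S.

Definition pre := lft S ++ coded_sub (img S) (start S) K.
Definition suf := coded_sub (img S) (stop S - K) K ++ rgt S.

Definition mid_wins m := [seq w.2 | w <- coded_wins (img S) (level S) m].
(** These windows start inside [lft S], while those of [suf_wins] end inside [rgt S]. *)
Definition pre_wins m := [seq sub i m pre | i <- iota 0 (size (lft S))].
Definition suf_wins m := [seq sub i m suf | i <- iota (K - m).+1 (size (rgt S))].
Definition wins m := mid_wins m ++ pre_wins m ++ suf_wins m.

(** By the last two bounds, a run longer than 2p with [p >= pmin S] that enters an end contains the
    marker there and its copy at distance [p]. *)
Definition sound_sizes :=
  [&& 0 < q, size (img S true) == q,
      nth false (img S false) 0 != nth false (img S true) 0,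
      nth false (img S false) q.-1 != nth false (img S true) q.-1,
      0 < size (lft S), 0 < size (rgt S), K <= stop S & K <= q * 2 ^ level S] &&
  [&& 0 < (low S).2, 0 < (high S).2, (low S).2 * 2 <= (low S).1,
      ((low S).1 * pmin S %/ (low S).2) < K, (reach S).*2 <= K, 0 < marker S, marker S <= K,
      0 < pmin S, pmin S <= K, size (lft S) + marker S <= (pmin S).+2 &
      size (rgt S) + marker S <= (pmin S).+2].

Definition synchronizing :=
  let ws := coded_wins (img S) (level S) (pmin S) in
  all (fun u => all (fun v => (u.2 == v.2) ==> (u.1 == v.1 %[mod q])) ws) ws.

(** The windows have the least length at which period [p] gives an exponent above [low S]. *)
Definition no_short_power :=
  all (fun p => all (fun w => ~~ periodic p w) (wins ((low S).1 * p %/ (low S).2).+1))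
    (iota 1 (pmin S).-1).

Definition lft_marker := sub (size (lft S)).-1 (marker S) pre.
Definition rgt_marker := sub (K - marker S).+1 (marker S) suf.

Definition unique_markers :=
  [&& lft_marker \notin mid_wins (marker S), lft_marker \notin suf_wins (marker S),
      rgt_marker \notin mid_wins (marker S) & rgt_marker \notin pre_wins (marker S)].

Definition extension_powers :=
  [&& all (ins_power (high S) (reach S)) (wins (reach S).*2),
      all (fun i => ins_power (high S) i (take K pre)) (iota 0 (reach S)) &
      all (fun i => ins_power (high S) (K - i) (drop (size (rgt S)) suf)) (iota 0 (reach S))].

Definition check := [&& sound_sizes, synchronizing, no_short_power, unique_markers & extension_powers].

Variable n : nat.
Definition word := lft S ++ coded_sub (img S) (start S) n ++ rgt S.

Hypothesis sizes : sound_sizes.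
Hypothesis n_large : K <= n.
Hypothesis suffix_eq : coded_sub (img S) (start S + n - K) K = coded_sub (img S) (stop S - K) K.

Lemma size_word : size word = size (lft S) + n + size (rgt S).
Proof. by rewrite !size_cat size_coded_sub addnA. Qed.

Lemma size_pre : size pre = size (lft S) + K.
Proof. by rewrite size_cat size_coded_sub. Qed.

Lemma size_suf : size suf = K + size (rgt S).
Proof. by rewrite size_cat size_coded_sub. Qed.

Lemma word_pre : word = pre ++ coded_sub (img S) (start S + K) (n - K) ++ rgt S.
Proof. by rewrite /word -{1}(subnKC n_large) coded_sub_cat -!catA. Qed.

Lemma word_suf : word = lft S ++ coded_sub (img S) (start S) (n - K) ++ suf.
Proof.
rewrite /word -{1}(subnK n_large) coded_sub_cat addnBA // suffix_eq.
by rewrite /suf -!catA.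
Qed.

Lemma nth_pre s : s < size (lft S) + K -> nth false word s = nth false pre s.
Proof. by rewrite -size_pre word_pre nth_cat => ->. Qed.

Lemma nth_suf s : nth false word (size (lft S) + (n - K) + s) = nth false suf s.
Proof.
rewrite word_suf catA nth_cat size_cat size_coded_sub.
by rewrite ltnNge leq_addr addKn.
Qed.

Lemma sub_pre i m : i + m <= size (lft S) + K -> sub i m word = sub i m pre.
Proof.
move=> him; apply: eq_sub; rewrite ?size_word ?size_pre //; first lia.
by move=> s hs; rewrite nth_pre //; lia.
Qed.

Lemma sub_suf i m :
  size (lft S) + n <= i + K -> i + m <= size word ->
  sub i m word = sub (i + K - size (lft S) - n) m suf.
Proof.
move=> hi him; apply: eq_sub; rewrite // ?size_suf.
  by move: him; rewrite size_word; lia.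
by move=> s hs; rewrite -nth_suf; congr (nth _ _ _); lia.
Qed.

Lemma sub_mid i m :
  size (lft S) <= i -> i + m <= size (lft S) + n ->
  sub i m word = coded_sub (img S) (start S + i - size (lft S)) m.
Proof.
move=> hi him; apply: (@eq_from_nth _ false).
  by rewrite size_sub ?size_coded_sub // size_word; lia.
rewrite size_sub ?size_word; last lia.
move=> s hs; rewrite nth_sub // nth_mkseq //.
rewrite /word nth_cat; case: ltnP => h1; first lia.
rewrite nth_cat size_coded_sub; case: ltnP => h2; last lia.
by rewrite nth_mkseq //; congr coded; lia.
Qed.

Lemma coded_mid_wins i m : m <= K -> coded_sub (img S) i m \in mid_wins m.
Proof.
move=> hm; case/andP: sizes => /and5P[q0 /eqP sz _ _ /and4P[_ _ _ hK]] _.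
apply/mapP; exists (i %% (q * 2 ^ level S), coded_sub (img S) i m) => //.
by apply: coded_sub_win => //; exact: leq_trans hK.
Qed.

Lemma sub_pre_wins i m :
  m <= K -> i < size (lft S) -> sub i m word \in pre_wins m.
Proof. by move=> hm hi; rewrite sub_pre; [apply: map_f; rewrite mem_iota|lia]. Qed.

Lemma sub_suf_wins i m :
  m <= K -> size (lft S) + n < i + m -> i + m <= size word ->
  sub i m word \in suf_wins m.
Proof.
move=> hm hi him; rewrite sub_suf //; last lia.
by apply: map_f; move: him; rewrite size_word mem_iota; lia.
Qed.

Lemma sub_mid_wins i m :
  m <= K -> size (lft S) <= i -> i + m <= size (lft S) + n ->
  sub i m word \in mid_wins m.
Proof. by move=> hm hi him; rewrite sub_mid // coded_mid_wins. Qed.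

Lemma sub_wins i m : m <= K -> i + m <= size word -> sub i m word \in wins m.
Proof.
move=> hm him; rewrite !mem_cat.
case: (ltnP i (size (lft S))) => hi; first by rewrite sub_pre_wins ?orbT.
case: (ltnP (size (lft S) + n) (i + m)) => hi'; first by rewrite sub_suf_wins ?orbT.
by rewrite sub_mid_wins.
Qed.

Lemma coded_sync i j :
  synchronizing -> coded_sub (img S) i (pmin S) = coded_sub (img S) j (pmin S) ->
  i = j %[mod q].
Proof.
case/andP: sizes => /and5P[q0 /eqP sz _ _ /and4P[_ _ _ hQ]].
case/and5P=> _ _ _ _ /and5P[_ _ _ _ /and3P[hp _ _]].
move=> /allP sync e; have hm := leq_trans hp hQ.
have win i' := @coded_sub_win _ q0 sz _ i' _ hm; have hi := win i; have hj := win j.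
have /allP/(_ _ hj) := sync _ hi; rewrite e eqxx /= => /eqP.
by rewrite !modn_dvdm // dvdn_mulr.
Qed.

(** * Powers in a word of the family *)

Definition run i p L :=
  forall s, s + p < L -> nth false word (i + (s + p)) = nth false word (i + s).

Lemma run_sub i p L j m :
  run i p L -> i + L <= size word -> i <= j -> j + m + p <= i + L ->
  sub (j + p) m word = sub j m word.
Proof.
move=> r hL hj hm; apply: eq_sub; try lia.
move=> s hs; have := r (j - i + s) ltac:(lia).
have -> : i + (j - i + s + p) = j + p + s by lia.
by have -> : i + (j - i + s) = j + s by lia.
Qed.

(* A run of long period covering the marker would repeat it elsewhere. *)
Lemma run_left i p L :
  unique_markers -> run i p L -> i + L <= size word -> p.*2 < L -> pmin S <= p ->
  size (lft S) <= i.
Proof.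
case/andP: sizes => /and5P[_ _ _ _ /and4P[l0 _ _ _]].
case/and5P=> _ _ _ _ /and5P[_ m0 hmK hp0 /and3P[_ hl _]].
case/and4P=> nmid nsuf _ _ r hL hpL hp; rewrite leqNgt; apply/negP => hi.
have e := @run_sub i p L (size (lft S)).-1 (marker S) r hL ltac:(lia) ltac:(lia).
rewrite [RHS]sub_pre in e; last lia.
(* The copy of the marker, [p] letters later, starts beyond [lft S]: only middle and suffix windows
   remain. *)
have hj : size (lft S) <= (size (lft S)).-1 + p by lia.
case: (ltnP (size (lft S) + n) ((size (lft S)).-1 + p + marker S)) => hi'.
  by move: nsuf; rewrite /lft_marker -e sub_suf_wins //; lia.
by move: nmid; rewrite /lft_marker -e sub_mid_wins.
Qed.

Lemma run_right i p L :
  unique_markers -> run i p L -> i + L <= size word -> p.*2 < L -> pmin S <= p ->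
  i + L <= size (lft S) + n.
Proof.
case/andP: sizes => /and5P[_ _ _ _ /and4P[_ r0 _ _]].
case/and5P=> _ _ _ _ /and5P[_ m0 hmK hp0 /and3P[_ _ hr]].
case/and4P=> _ _ nmid npre r hL hpL hp; rewrite leqNgt; apply/negP => hi.
move: (hL); rewrite size_word => hL'.
(* The copy of the right marker [p] letters earlier starts at [j]. *)
pose j := (size (lft S) + n - marker S).+1 - p.
have e := @run_sub i p L j (marker S) r hL ltac:(lia) ltac:(lia).
rewrite [LHS]sub_suf ?size_word in e; try lia.
have ej : j + p + K - size (lft S) - n = (K - marker S).+1 by lia.
rewrite ej in e.
case: (ltnP j (size (lft S))) => hj.
  by move: npre; rewrite /rgt_marker e sub_pre_wins.
by move: nmid; rewrite /rgt_marker e sub_mid_wins //; lia.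
Qed.

Lemma word_power_free (u : seq bool) p :
  synchronizing -> no_short_power -> unique_markers ->
  infix u word -> is_period u p -> size u * (low S).2 <= (low S).1 * p.
Proof.
move=> sync short marks /infixE[i0 [eu hL]]; rewrite is_period_periodic => /andP[p0 per].
rewrite leqNgt; apply/negP => big.
case/andP: (sizes) => /and5P[q0 /eqP sz hd ls _].
case/and5P=> d0 _ low2 hK /and5P[_ _ _ pm0 /and3P[pmK _ _]].
have r : run i0 p (size u).
  move=> s hs; have := periodicP _ _ per s hs.
  by rewrite eu !nth_sub //; exact: leq_ltn_trans (leq_addr _ _) hs.
case: (ltnP p (pmin S)) => hp.
  set L := ((low S).1 * p %/ (low S).2).+1.
  have hLu : L <= size u by rewrite ltn_divLR.
  have hLK : L <= K.
    apply: leq_trans hK; rewrite ltnS /L; apply: leq_div2r; rewrite leq_mul2l.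
    by rewrite ltnW ?orbT.
  move: hLu hLK; clear - L r hL p0 hp short sizes n_large suffix_eq => hLu hLK.
  have /allP/(_ p) := short; rewrite mem_iota => /(_ ltac:(lia))/allP.
  move=> /(_ _ (sub_wins hLK (leq_trans (_ : i0 + L <= _) hL))).
  rewrite leq_add2l => /(_ hLu)/negP; apply; apply/periodicP => s.
  rewrite size_sub; last lia.
  by move=> hs; rewrite !nth_sub; [apply: r| |]; lia.
(* As [low S] is at least 2, the power is longer than twice its period. *)
have hpL : p.*2 < size u.
  rewrite -(ltn_pmul2r d0); apply: leq_ltn_trans big; rewrite -muln2 -mulnA mulnC.
  by rewrite leq_mul2r mulnC low2 orbT.
clear big low2 hK.
have hl := run_left marks r hL hpL hp; have hr := run_right marks r hL hpL hp.
pose i := start S + i0 - size (lft S).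
have coded_run s : s <= p -> coded (img S) (i + s + p) = coded (img S) (i + s).
  move=> hs; have := r s ltac:(lia).
  have := @sub_mid i0 (size u) hl hr; rewrite -/i => es.
  have hs1 : s + p < size u by lia.
  have hs2 : s < size u by lia.
  by rewrite -(nth_sub i0 word hs1) -(nth_sub i0 word hs2) es !nth_mkseq // addnA.
apply: (coded_overlap_free q0 hd ls p0 _ coded_run).
(* Since [pmin S <= p], the windows of length [pmin S] at [i] and [i + p] agree, and synchronization
   applies. *)
have : i + p = i %[mod q].
  apply: coded_sync => //; rewrite /coded_sub /mkseq; apply/eq_in_map => s.
  by rewrite mem_iota => hs; rewrite addnAC coded_run //; lia.
by move/eqP; rewrite -{2}(addn0 i) eqn_modDl mod0n.
Qed.

Lemma word_extension i b :
  extension_powers -> i <= size word ->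
  exists u p, [/\ infix u (ins i b word), is_period u p & (high S).1 * p <= size u * (high S).2].
Proof.
case/and3P=> /allP hmid /allP hlft /allP hrgt hi.
case/andP: (sizes) => _ /and5P[_ h0 _ _ /and3P[hK _ _]].
have main lo m : lo <= i <= lo + m -> lo + m <= size word ->
    ins_power (high S) (i - lo) (sub lo m word) ->
    exists u p, [/\ infix u (ins i b word), is_period u p
                  & (high S).1 * p <= size u * (high S).2].
  move=> hlo hm /andP[hf ht].
  have {}hf : has_power (high S) (ins (i - lo) b (sub lo m word)) by case: (b).
  have [u [p [inf per le]]] := has_powerP h0 hf; exists u, p; split=> //.
  by apply: infix_trans inf _; exact: infix_ins_sub.
have sz := size_word.
(* Near an end the window is the first or last [K] letters; elsewhere it is centred at the
   insertion. *)
case: (ltnP i (reach S)) => hi1.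
  apply: (@main 0 K); try lia.
  rewrite subn0 sub_pre; last lia.
  by rewrite /sub drop0; apply: hlft; rewrite mem_iota.
case: (ltnP (size word) (i + reach S)) => hi2.
  apply: (@main (size word - K) K); try lia.
  rewrite sub_suf; try lia.
  have -> : i - (size word - K) = K - (size word - i) by lia.
  have -> : size word - K + K - size (lft S) - n = size (rgt S) by lia.
  rewrite /sub take_oversize; last by rewrite size_drop size_suf; lia.
  by apply: hrgt; rewrite mem_iota; lia.
apply: (@main (i - reach S) (reach S).*2); try lia.
rewrite subKn //; apply: hmid; apply: sub_wins; lia.
Qed.

End Family.

Lemma arbitrarily_long S : check S -> forall N, exists w,
  [/\ N <= size w,
      forall u p, infix u w -> is_period u p -> size u * (low S).2 <= (low S).1 * p &
      forall i b, i <= size w -> exists u p,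
        [/\ infix u (ins i b w), is_period u p & (high S).1 * p <= size u * (high S).2]].
Proof.
case/and5P=> sizes sync short marks exts N.
case/andP: (sizes) => /and5P[q0 _ _ _ /and4P[_ _ hstop _]] _.
set q := width (img S) in q0; set K := margin S in hstop.
(* As [Q] exceeds [stop S], translation by 3Q preserves the letters of [x] before [stop S]; the
   summand [N] makes the word long enough. *)
pose j := N + start S + stop S + K; pose Q := q * 2 ^ j.
have hQ : j < Q by apply: leq_trans (ltn_expl j (ltnSn 1)) _; rewrite leq_pmull.
pose n := 3 * Q + stop S - start S.
have nK : K <= n by lia.
have suffix_eq : coded_sub (img S) (start S + n - K) K = coded_sub (img S) (stop S - K) K.
  rewrite /coded_sub /mkseq; apply/eq_in_map => s; rewrite mem_iota => hs.
  have -> : start S + n - K + s = 3 * Q + (stop S - K + s) by lia.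
  by apply: (coded_shift q0); rewrite -/q -/Q; lia.
exists (word S n); split.
- by rewrite size_word; lia.
- by move=> u p; exact: word_power_free.
- by move=> i b; exact: word_extension.
Qed.

(** * The five families *)

(* The codes of the characters 0 and 1 differ in their lowest bit. *)
Fixpoint bits (s : string) : seq bool :=
  if s is String (Ascii.Ascii b _ _ _ _ _ _ _) s' then b :: bits s' else [::].

(* The letters of each image, and the words at the two ends, were found by
   computer search. *)
Definition img_mid b := bits (if b then "1001011001101100100110010110"
                              else "0110100110010011011001101001")%string.

Definition img_high b := bits (if b then "10010100110011011001"
                               else "01100100110011010110")%string.

(** With one-letter images, [x] is the Thue-Morse word itself. *)
Definition spec1 : spec := {|
  img := fun b => [:: b]; lft := bits "0"%string; rgt := bits "1"%string;
  start := 3; stop := 29; low := (2, 1); high := (7, 3);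
  margin := 13; level := 4; marker := 5; pmin := 6; reach := 5 |}.

Definition spec2 : spec := {|
  img := img_mid; lft := bits "01"%string; rgt := bits "01"%string;
  start := 31; stop := 81; low := (7, 3); high := (12, 5);
  margin := 45; level := 1; marker := 12; pmin := 19; reach := 13 |}.

Definition spec3 : spec := {|
  img := img_mid; lft := bits "01101100"%string; rgt := bits "11001001"%string;
  start := 34; stop := 78; low := (12, 5); high := (5, 2);
  margin := 58; level := 2; marker := 16; pmin := 24; reach := 14 |}.

Definition spec4 : spec := {|
  img := img_high; lft := bits "0011011001001"%string; rgt := bits "0110110010011"%string;
  start := 59; stop := 101; low := (5, 2); high := (13, 5);
  margin := 68; level := 2; marker := 14; pmin := 27; reach := 12 |}.

Definition spec5 : spec := {|
  img := img_high; lft := bits "011"%string; rgt := bits "001"%string;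
  start := 27; stop := 133; low := (13, 5); high := (8, 3);
  margin := 34; level := 1; marker := 10; pmin := 13; reach := 12 |}.

Lemma check1 : check spec1. Proof. by vm_compute. Qed.
Lemma check2 : check spec2. Proof. by vm_compute. Qed.
Lemma check3 : check spec3. Proof. by vm_compute. Qed.
Lemma check4 : check spec4. Proof. by vm_compute. Qed.
Lemma check5 : check spec5. Proof. by vm_compute. Qed.

(** * From periods to real exponents *)

Import Order.TTheory GRing.Theory Num.Theory.
Local Open Scope ring_scope.

Definition ratio (R : realType) (e : nat * nat) : R := e.1%:R / e.2%:R.

Lemma min_periodP (w : seq bool) :
  is_period w (min_period w) /\ forall p, is_period w p -> (min_period w <= p)%N.
Proof. by rewrite /min_period; case: ex_minnP. Qed.

Lemma exponent_gt (R : realType) (e : nat * nat) (w : seq bool) :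
  (0 < e.2)%N -> ratio R e < exponent R w ->
  exists2 p, is_period w p & (e.1 * p < size w * e.2)%N.
Proof.
move=> e0; have [per _] := min_periodP w; have /andP[p0 _] := per.
rewrite /ratio /exponent ltr_pdivrMr ?ltr0n // mulrAC ltr_pdivlMr ?ltr0n //.
by rewrite -!natrM ltr_nat => h; exists (min_period w).
Qed.

Lemma exponent_ge (R : realType) (e : nat * nat) (w : seq bool) p :
  (0 < e.2)%N -> is_period w p -> (e.1 * p <= size w * e.2)%N ->
  ratio R e <= exponent R w.
Proof.
move=> e0 per le; have [/andP[p0 _] /(_ _ per) min_le] := min_periodP w.
rewrite /ratio /exponent ler_pdivrMr ?ltr0n // mulrAC ler_pdivlMr ?ltr0n //.
by rewrite -!natrM ler_nat; apply: leq_trans le; rewrite leq_mul2l min_le orbT.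
Qed.

Lemma extremal_family (R : realType) (beta : extended R) S N :
  check S -> (xplus (ratio R (low S)) <= beta)%O -> (beta <= xreal (ratio R (high S)))%O ->
  exists w : seq bool, (N <= size w)%N /\ extremal_free beta w.
Proof.
move=> ok lo hi; have /andP[/andP[_ /and5P[l0 h0 _ _ _]] _] := ok.
have [w [hN free ext]] := arbitrarily_long ok N; exists w; split=> //; split.
  move=> [u inf]; move/(le_trans lo); rewrite xplus_le_real => /(exponent_gt l0)[p per].
  by rewrite ltnNge free.
move=> _ [w1 [b [w2 [-> e]]]].
have [|u [p [inf per le]]] := ext (size w1) b; first by rewrite -e size_cat leq_addr.
exists u; first by move: inf; rewrite /ins -e take_size_cat // drop_size_cat.
by apply: le_trans hi _; rewrite xreal_le_real; exact: exponent_ge per le.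
Qed.

Theorem theorem1p4 (R : realType) (beta : extended R)
    (hbeta : (xplus 2 <= beta <= xreal (8 / 3))%O) (N : nat) :
  exists w : seq bool, (N <= size w)%N /\ extremal_free beta w.
Proof.
case/andP: hbeta => lo hi.
(* Nothing lies strictly between [xreal y] and [xplus y]. *)
have split_at y : (beta <= xreal y)%O \/ (xplus y <= beta)%O.
  case: (leP beta (xreal y)) => h; [by left|right].
  by rewrite leNgt; apply/negP => h'; have [_] := xplus_covers y beta; rewrite h h'.
have [h1|h1] := split_at (ratio R (7, 3)).
  by apply: (extremal_family N check1); rewrite //= /ratio divr1.
have [h2|h2] := split_at (ratio R (12, 5)); first exact: (extremal_family N check2).
have [h3|h3] := split_at (ratio R (5, 2)); first exact: (extremal_family N check3).
have [h4|h4] := split_at (ratio R (13, 5)); first exact: (extremal_family N check4).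
exact: (extremal_family N check5).
Qed.
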